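(* Let $m$ be an even positive integer, written as $m=2^k n$ with $n$ odd and $k\ge1$, and let $M=\{a_1,\dots,a_m\}$ be a multiset of $m$ elements of $\mathbb{Z}_m$. Suppose that (i) it is not the case that all elements of $M$ have the same odd residue modulo $2^k$, and (ii) $M$ is not of the form $\{a,a,\dots,a,a+b,a-b\}$ (with $m-2$ copies of $a$) with $a$ even and $\gcd(b,m)=1$. Then, after a suitable permutation of the indices, $\sum_{i=1}^m i a_i=0$ in $\mathbb{Z}_m$. *)

(* Defs.v *)
From mathcomp Require Import all_boot all_order all_algebra all_fingroup.

Set Implicit Arguments.
Unset Strict Implicit.
Unset Printing Implicit Defensive.

Import GRing.Theory.
Local Open Scope ring_scope.

(* The predicates below take the canonical representative of an element of 'Z_m
   in {0, ..., m - 1}; they are well defined on residue classes when 1 < m and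
   d divides m (resp. when m is even, for the parity in exceptional_form). *)

Definition same_odd_residue (m d : nat) (M : seq 'Z_m) : Prop :=
  exists r : nat, odd r /\ forall x : 'Z_m, x \in M -> (x : nat) = r %[mod d].

(* perm_eq is equality of the underlying multisets. *)
Definition exceptional_form (m : nat) (M : seq 'Z_m) : Prop :=
  exists a b : 'Z_m,
    [/\ ~~ odd (a : nat), coprime (b : nat) m
      & perm_eq M (nseq (m - 2) a ++ [:: a + b; a - b])].

(* Main.v *)
(* The key bound: if the n terms of s are not all congruent modulo any prime
   divisor of g, then the sums with weights 0, ..., n - 1 take at least n values
   modulo g for n < g, at least g - 1 for n = g, and all g for n > g.  Removing a
   term x and putting it back with weight 0 or n - 1 gives two translates of the
   set of sums of the other terms, by amounts differing by n x - (sum of s): either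
   one value is gained or the set of sums is periodic, and then one passes to a
   proper quotient of Z_g.  The removed term can be chosen so that the remaining
   ones still span and the difference is nonzero, unless every term is needed.

   Write m = 2q.  If all terms have the same parity, M = a + 2 M' and the bound
   applies to the 2q terms of M' in the subgroup of Z_q that they generate.
   Otherwise take x, y of opposite parity and give them the weights 0 and q:
   exchanging them changes the sum by q, so it is enough to get 0 modulo q from
   the other 2q - 2 terms, carrying the weights 1, ..., q - 1 twice.  Splitting
   them into two halves sharing a common residue a, both nonconstant, the sums of
   one half meet the opposites of those of the other.  This can fail only if
   2q - 3 of them are congruent modulo q; another choice of x and y, or an
   explicit arrangement, then works outside the exceptional family. *)

Require Import Defs.
From mathcomp Require Import all_boot all_order all_algebra all_fingroup.
From mathcomp Require Import zify ring.

Set Implicit Arguments.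
Unset Strict Implicit.
Unset Printing Implicit Defensive.

Import GRing.Theory.
Local Open Scope ring_scope.

(* Linear arithmetic over the counts of a goal; abstracting the booleans spares
   lia the case analyses. *)
Ltac count_lia :=
  clear;
  repeat match goal with
  | |- context [count ?p ?s] => move: (count p s) => ?
  | |- context [nat_of_bool ?b] => move: (nat_of_bool b) => ?
  end; lia.

(** * Weighted sums of integer sequences *)

(** The weights are [w], [w + 1], and so on. Terms are integers rather than residues, so that one
    sequence can be read modulo several moduli and divided by a common factor. *)
Fixpoint wsum (w : int) (s : seq int) : int :=
  if s is x :: s' then w * x + wsum (w + 1) s' else 0.

Lemma wsum_cat w s t : wsum w (s ++ t) = wsum w s + wsum (w + (size s)%:Z) t.
Proof.
elim: s w => [|x s IHs] w /=; first by rewrite add0r addr0.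
rewrite IHs addrA; congr (_ + wsum _ _); lia.
Qed.

Lemma wsum_shift v w s : wsum (v + w) s = v * (\sum_(x <- s) x) + wsum w s.
Proof.
elim: s w => [|x s IHs] w /=; first by rewrite big_nil mulr0.
by rewrite big_cons -addrA IHs; ring.
Qed.

Lemma wsum_affine w a d s :
  wsum w [seq a + d * x | x <- s] = a * wsum w (nseq (size s) 1) + d * wsum w s.
Proof.
elim: s w => [|x s IHs] w /=; first by rewrite !mulr0.
by rewrite IHs; ring.
Qed.

(** Arithmetic series, doubled to avoid a division by 2. *)
Lemma wsum_nseq1 w n :
  2 * wsum w (nseq n 1) = n%:Z * (2 * w + n%:Z - 1).
Proof.
elim: n w => [|n IHn] w /=; first by rewrite mulr0 mul0r.
by rewrite mulrDr IHn intS; ring.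
Qed.

Lemma wsum_const (d w a : int) s :
  (forall x, x \in s -> (d %| x - a)%Z) ->
  (d %| wsum w s - a * wsum w (nseq (size s) 1))%Z.
Proof.
elim: s w => [|x s IHs] w sP /=; first by rewrite mulr0 subrr dvdz0.
have -> : w * x + wsum (w + 1) s - a * (w * 1 + wsum (w + 1) (nseq (size s) 1))
  = w * (x - a) + (wsum (w + 1) s - a * wsum (w + 1) (nseq (size s) 1)) by ring.
rewrite rpredD ?dvdz_mull ?sP ?mem_head ?IHs // => y sy.
by apply: sP; rewrite inE sy orbT.
Qed.

(** * Attained sums and periodic sets of integers *)

(** A boolean, by search among the permutations, so that the attained residues can be counted. *)
Definition attains (g : nat) (s : seq int) (c : int) :=
  has (fun t => (g %| wsum 0 t - c)%Z) (permutations s).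

Lemma attainsP (g : nat) s c :
  reflect (exists2 t, perm_eq t s & (g %| wsum 0 t - c)%Z) (attains g s c).
Proof.
by apply: (iffP hasP) => -[t];
  [rewrite mem_permutations|rewrite -mem_permutations]; exists t.
Qed.

Lemma attains_perm g s t : perm_eq s t -> attains g s =1 attains g t.
Proof.
move=> st c; apply/attainsP/attainsP => -[r rs]; exists r => //.
- exact: perm_trans rs st.
- by rewrite perm_sym in st; apply: perm_trans rs st.
Qed.

Definition periodic (h : int) (P : pred int) := forall c : int, P (c + h) = P c.

Lemma periodic_mul h P k : periodic h P -> periodic (k * h) P.
Proof.
move=> hP; case: k => n.
  elim: n => [|n IHn] c; first by rewrite mul0r addr0.
  by rewrite intS mulrDl mul1r addrA IHn hP.
rewrite NegzE; elim: n => [|n IHn] c; first by rewrite -[LHS]hP mulN1r addrNK.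
rewrite -[RHS]IHn -[LHS]hP; congr P; rewrite [n.+2%:Z]intS; ring.
Qed.

Lemma periodic_gcd h k P :
  periodic h P -> periodic k P -> periodic (gcdz h k) P.
Proof.
move=> hP kP c; have [u [v <-]] := Bezoutz h k.
by rewrite addrA (periodic_mul _ kP) (periodic_mul _ hP).
Qed.

Lemma attains_periodic (g : nat) s : periodic g (attains g s).
Proof.
move=> c; apply/attainsP/attainsP => -[t ts tc]; exists t => //.
- have -> : wsum 0 t - c = wsum 0 t - (c + g%:Z) + g%:Z by ring.
  by rewrite rpredD ?dvdzz.
- have -> : wsum 0 t - (c + g%:Z) = wsum 0 t - c - g%:Z by ring.
  by rewrite rpredB ?dvdzz.
Qed.

(** * Counting the residues in a periodic set *)

Definition nresidues (g : nat) (P : pred int) : nat := \sum_(0 <= i < g) P i%:Z.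

Lemma nresiduesE g P : nresidues g P = count (fun i : nat => P i%:Z) (iota 0 g).
Proof.
rewrite /nresidues /index_iota subn0.
by elim: (iota 0 g) => [|i s IHs]; rewrite ?big_nil ?big_cons //= IHs.
Qed.

(** By periodicity, a shift by 1 only moves one summand from one end of the range to the other; a
    general [u] is first reduced modulo [g]. *)
Lemma nresidues_shift (g : nat) (P : pred int) (u : int) :
  (0 < g)%N -> periodic g P -> nresidues g (fun c => P (c + u)) = nresidues g P.
Proof.
move=> g_gt0 gP.
have shift1 (v : int) :
  nresidues g (fun c => P (c + v + 1)) = nresidues g (fun c => P (c + v)).
  rewrite /nresidues -[in LHS](prednK g_gt0) -[in RHS](prednK g_gt0).
  rewrite big_nat_recr //= [RHS]big_nat_recl //= addnC; congr (_ + _)%N.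
    rewrite add0r -[in RHS]gP; congr (nat_of_bool (P _)); lia.
  apply: eq_bigr => i _; congr (nat_of_bool (P _)); lia.
have shiftn n : nresidues g (fun c => P (c + n%:Z)) = nresidues g P.
  elim: n => [|n IHn]; first by apply: eq_bigr => i _; rewrite addr0.
  rewrite -IHn -[RHS]shift1; apply: eq_bigr => i _; congr (nat_of_bool (P _)); lia.
rewrite -(shiftn `|(u %% g)%Z|%N); apply: eq_bigr => i _.
rewrite gez0_abs ?modz_ge0 //; last by lia.
rewrite [in LHS](divz_eq u g) addrCA addrC.
by rewrite (periodic_mul (u %/ g)%Z gP).
Qed.

Lemma nresidues_mul (h e : nat) (P : pred int) :
  periodic h P -> nresidues (e * h) P = (e * nresidues h P)%N.
Proof.
move=> hP; elim: e => [|e IHe]; first by rewrite /nresidues big_geq.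
rewrite mulSnr /nresidues (@big_cat_nat _ _ _ (e * h)) ?leq_addr //= mulSnr.
rewrite -/(nresidues _ _) IHe; congr (_ + _)%N.
rewrite -{1}[(e * h)%N]add0n big_addn addKn.
by apply: eq_bigr => i _; rewrite PoszD PoszM (periodic_mul e%:Z hP).
Qed.

Lemma nresidues_le g (P Q : pred int) :
  (forall c, P c -> Q c) -> (nresidues g P <= nresidues g Q)%N.
Proof. by move=> PQ; apply: leq_sum => i _; have := PQ i; case: (P i) => [->|]. Qed.

Lemma nresidues_max g P : (nresidues g P <= g)%N.
Proof. by rewrite nresiduesE (leq_trans (count_size _ _)) ?size_iota. Qed.

Lemma periodic_mod (g : nat) (P : pred int) (c : int) : periodic g P ->
  P (c %% g)%Z = P c.
Proof.
by move=> gP; rewrite [in RHS](divz_eq c g) addrC (periodic_mul (c %/ g)%Z gP).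
Qed.

(** A residue in [Q] but not in [P] would make the count of [Q] strictly larger. *)
Lemma nresidues_eq (g : nat) (P Q : pred int) : (0 < g)%N ->
  periodic g P -> periodic g Q -> (forall c, P c -> Q c) ->
  (nresidues g Q <= nresidues g P)%N -> Q =1 P.
Proof.
move=> g_gt0 gP gQ PQ leQP.
have eqn (i : nat) : (i < g)%N -> Q i = P i.
  move=> lt_ig; apply/idP/idP; last exact: PQ.
  move=> Qi; apply: contraLR leQP => nPi; rewrite -ltnNge !nresiduesE.
  have i_in : i \in iota 0 g by rewrite mem_iota.
  rewrite !(seq.permP (perm_to_rem i_in)) /= (negbTE nPi) Qi add0n add1n ltnS.
  by apply: sub_count => j; apply: PQ.
move=> c; rewrite -(periodic_mod c gQ) -(periodic_mod c gP).
have: 0 <= (c %% g)%Z < g%:Z by lia.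
by case: (c %% g)%Z => // i ?; apply: eqn; lia.
Qed.

Lemma nresidues_uniq (g : nat) (P : pred int) (cs : seq int) : (0 < g)%N ->
  periodic g P -> all P cs -> pairwise (fun c d => ~~ (g %| c - d)%Z) cs ->
  (size cs <= nresidues g P)%N.
Proof.
move=> g_gt0 gP Pcs ncs; have g0 : g%:Z != 0 by lia.
rewrite nresiduesE -size_filter -(size_map (fun c => `|(c %% g)%Z|%N)).
apply: uniq_leq_size.
  rewrite uniq_pairwise pairwise_map; apply: sub_pairwise ncs => c d /=.
  apply: contra => /eqP eqcd; rewrite -eqz_mod_dvd; apply/eqP.
  by rewrite -(gez0_abs (modz_ge0 c g0)) eqcd gez0_abs ?modz_ge0.
move=> _ /mapP[c cin ->]; rewrite mem_filter mem_iota /= add0n.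
rewrite gez0_abs ?modz_ge0 // (periodic_mod c gP) (allP Pcs) //=.
by rewrite -ltz_nat gez0_abs ?modz_ge0 // ltz_pmod.
Qed.

(** * Effect of one more term on the number of sums *)

(** Replacing [x] by [a] makes the sequence constant modulo [d] and changes the sum by the weight of
    [x] times [x - a]. *)
Lemma wsum_insert (d w a x : int) s1 s2 :
  (forall y, y \in s1 ++ s2 -> (d %| y - a)%Z) ->
  (d %| wsum w (s1 ++ x :: s2)
        - (a * wsum w (nseq (size (s1 ++ s2)).+1 1)
           + (w + (size s1)%:Z) * (x - a)))%Z.
Proof.
move=> sP; have := @wsum_const d w a (s1 ++ a :: s2).
rewrite !size_cat /= addnS !wsum_cat /= => /(_ _)-dP.
set W := a * _ in dP *.
have -> : wsum w s1 + ((w + (size s1)%:Z) * x + wsum (w + (size s1)%:Z + 1) s2) -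
    (W + (w + (size s1)%:Z) * (x - a)) =
   wsum w s1 + ((w + (size s1)%:Z) * a + wsum (w + (size s1)%:Z + 1) s2) - W
  by ring.
apply: dP => y; rewrite mem_cat inE orbCA -mem_cat => /predU1P[->|/sP//].
by rewrite subrr dvdz0.
Qed.

(** With [x] at weight 0, every other weight grows by 1, which adds the plain sum of [s]. *)
Lemma attains_cons (g : nat) x s c :
  attains g s c -> attains g (x :: s) (c + \sum_(y <- s) y).
Proof.
move=> /attainsP[t ts tc]; apply/attainsP; exists (x :: t).
  by rewrite perm_cons.
rewrite /= mul0r add0r [0 + 1]addrC wsum_shift mul1r (perm_big _ ts) /=.
by rewrite [c + _]addrC opprD addrACA subrr add0r.
Qed.

Lemma attains_rcons (g : nat) x s c :
  attains g s c -> attains g (x :: s) (c + (size s)%:Z * x).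
Proof.
move=> /attainsP[t ts tc]; apply/attainsP; exists (rcons t x).
  by rewrite perm_rcons perm_cons.
by rewrite -cats1 wsum_cat /= (perm_size ts) !add0r addr0 opprD addrACA subrr addr0.
Qed.

Definition nsums (g : nat) (s : seq int) : nat := nresidues g (attains g s).

Lemma nsums_perm g s t : perm_eq s t -> nsums g s = nsums g t.
Proof. by move=> st; apply: eq_bigr => i _; rewrite (attains_perm _ st). Qed.

Lemma nsums_gt0 g s : (0 < g)%N -> (0 < nsums g s)%N.
Proof.
move=> g_gt0; apply: (@nresidues_uniq g _ [:: wsum 0 s]) => //.
  exact: attains_periodic.
by rewrite /= andbT; apply/attainsP; exists s; rewrite ?subrr ?dvdz0.
Qed.

Lemma nsums_cons g x s : (0 < g)%N -> (nsums g s <= nsums g (x :: s))%N.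
Proof.
move=> g_gt0.
rewrite /nsums -(nresidues_shift (- \sum_(y <- s) y) g_gt0 (@attains_periodic g s)).
by apply: nresidues_le => c /(attains_cons x); rewrite addrNK.
Qed.

(** If no value is gained, the two translates obtained by putting [x] first or last both equal the
    whole set of sums, which is thus invariant under their difference. *)
Lemma nsums_step g x s : (0 < g)%N ->
  (nsums g s < nsums g (x :: s))%N \/
  periodic ((size s)%:Z * x - \sum_(y <- s) y) (attains g (x :: s)).
Proof.
move=> g_gt0; have gP t := @attains_periodic g t.
have shift_per u : periodic g (fun c => attains g s (c - u)).
  by move=> c; rewrite addrAC gP.
case: ltnP => [|le_om]; [by left | right].
have nsums_eq u : (forall c, attains g s c -> attains g (x :: s) (c + u)) ->
    forall c, attains g (x :: s) c = attains g s (c - u).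
  move=> uP; apply: nresidues_eq (shift_per u) _ _ _ => //.
    by move=> c /uP; rewrite addrNK.
  by rewrite (nresidues_shift (- u) g_gt0 (gP s)).
move=> c.
rewrite (nsums_eq _ (@attains_rcons g x s)) (nsums_eq _ (@attains_cons g x s)).
by congr (attains g s _); ring.
Qed.

(** An [h]-periodic set of sums modulo [g] is the full preimage of the set of sums modulo [h]. *)
Lemma nsums_periodic g h s : (0 < g)%N -> (h %| g)%N ->
  periodic h (attains g s) -> nsums g s = (g %/ h * nsums h s)%N.
Proof.
move=> g_gt0 hg hP; rewrite /nsums -{1}(divnK hg) (nresidues_mul _ hP).
congr (_ * _)%N; apply: eq_bigr => i _; congr nat_of_bool.
apply/idP/idP => /attainsP[t ts].
  by move=> gt; apply/attainsP; exists t => //; apply: dvdz_trans gt.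
case/dvdzP => k tk.
have <- : wsum 0 t + (- k) * h%:Z = i by rewrite mulNr -tk; ring.
rewrite (periodic_mul (- k) hP).
by apply/attainsP; exists t => //; rewrite subrr dvdz0.
Qed.

(** Inserting [x] at position [i] gives, modulo [p], a constant plus [i * (x - a)]; the positions
    are smaller than or equal to [size s < p], so these sums are distinct. *)
Lemma nsums_insert (g p : nat) (x a : int) (s : seq int) : (0 < g)%N ->
  prime p -> (p %| g)%N ->
  (size s < p)%N -> (forall y, y \in s -> (p %| y - a)%Z) ->
  ~~ (p %| x - a)%Z -> (size s < nsums g (x :: s))%N.
Proof.
move=> g_gt0 p_pr pg le_sp sP npx.
pose c i := wsum 0 (take i s ++ x :: drop i s).
rewrite -[(size s).+1](size_mkseq c); apply: nresidues_uniq => //.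
- exact: attains_periodic.
- apply/allP => _ /mapP[i _ ->]; apply/attainsP.
  exists (take i s ++ x :: drop i s); rewrite ?subrr ?dvdz0 //.
  by rewrite perm_catC cat_cons perm_cons perm_catC cat_take_drop.
rewrite /mkseq pairwise_map.
have : pairwise ltn (iota 0 (size s).+1).
  by rewrite -sorted_pairwise ?iota_ltn_sorted //; apply: ltn_trans.
apply: (@sub_in_pairwise _ [pred i | i <= size s]%N); last first.
  by apply/allP => i; rewrite mem_iota /= add0n ltnS.
move=> i j /=; rewrite !inE => le_is le_js lt_ij; apply: contra npx => gc.
pose W := a * wsum 0 (nseq (size s).+1 1).
have cP k : (k <= size s)%N -> (p %| c k - (W + k%:Z * (x - a)))%Z.
  move=> le_ks.
  have := @wsum_insert p 0 a x (take k s) (drop k s).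
  by rewrite cat_take_drop add0r size_takel //; apply.
have pij : (p %| (j%:Z - i%:Z) * (x - a))%Z.
  have -> : (j%:Z - i%:Z) * (x - a) = (c i - (W + i%:Z * (x - a))) -
    (c j - (W + j%:Z * (x - a))) - (c i - c j) by ring.
  by apply: rpredB; [apply: rpredB; apply: cP | apply: dvdz_trans gc].
move: pij; rewrite Gauss_dvdzr // coprimezE prime_coprime //=.
have lt_jp : (j < p)%N by apply: leq_ltn_trans le_sp.
rewrite gtnNdvd //; lia.
Qed.

(** * Spanning sequences and the lower bound on the number of sums *)

Lemma sum_const (d a : int) (s : seq int) : (forall x, x \in s -> (d %| x - a)%Z) ->
  (d %| \sum_(x <- s) x - (size s)%:Z * a)%Z.
Proof.
elim: s => [|x s IHs] sP; first by rewrite big_nil mul0r subrr dvdz0.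
rewrite big_cons /= intS.
have -> : x + \sum_(y <- s) y - (1 + (size s)%:Z) * a =
  (x - a) + (\sum_(y <- s) y - (size s)%:Z * a) by ring.
by rewrite rpredD ?sP ?mem_head ?IHs // => y sy; rewrite sP // inE sy orbT.
Qed.

(* The differences of terms of s generate Z_g, tested one prime at a time. *)
Definition spans (g : nat) (s : seq int) : bool :=
  all (fun p : nat => has (fun x => has (fun y => ~~ (p %| x - y)%Z) s) s)
    (primes g).

Lemma spansPn (g : nat) (s : seq int) : (0 < g)%N ->
  reflect (exists p, [/\ prime p, (p %| g)%N &
             forall x y, x \in s -> y \in s -> (p %| x - y)%Z])
    (~~ spans g s).
Proof.
move=> g_gt0; apply: (iffP idP).
  case/allPn => p; rewrite mem_primes g_gt0 /= => /andP[p_pr pg] np.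
  exists p; split=> // x y sx sy; apply: contraR np => npxy.
  by apply/hasP; exists x => //; apply/hasP; exists y.
case=> p [p_pr pg pP]; apply/allPn; exists p; first by rewrite mem_primes p_pr g_gt0.
apply/hasPn => x sx; apply/hasPn => y sy.
by rewrite negbK pP.
Qed.

Lemma spans_not_const (g p : nat) (a : int) (s : seq int) : (0 < g)%N ->
  spans g s -> prime p ->
  (p %| g)%N -> ~ (forall x, x \in s -> (p %| x - a)%Z).
Proof.
move=> g_gt0 gs p_pr pg sP; suff /negP : ~~ spans g s by [].
apply/spansPn => //; exists p; split=> // x y sx sy.
have -> : x - y = (x - a) - (y - a) by ring.
by rewrite rpredB ?sP.
Qed.

Lemma spans_dvd g h s : (0 < g)%N -> (h %| g)%N -> spans g s -> spans h s.
Proof.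
move=> g_gt0 hg; have h_gt0 := dvdn_gt0 g_gt0 hg.
apply: contraLR => /(spansPn _ h_gt0)[p [p_pr ph pP]].
by apply/spansPn => //; exists p; split=> //; apply: dvdn_trans hg.
Qed.

(** The quantity that must not vanish is the period of [nsums_step] for the removed term [x]. If it
    vanished for every removable term, all terms would agree modulo a prime factor of [g]. *)
Lemma exists_removable (g : nat) (s : seq int) (x0 : int) : (0 < g)%N ->
  spans g s -> x0 \in s ->
  spans g (rem x0 s) -> ~~ (g %| size s)%N ->
  exists x, [/\ x \in s, spans g (rem x s)
    & ~~ (g %| (size s)%:Z * x - \sum_(y <- s) y)%Z].
Proof.
move=> g_gt0 gs sx0 gx0 ngn; set n := size s; set sg := \sum_(y <- s) y.
have [/hasP[x sx /andP[]]|/hasPn all_z] :=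
  boolP (has (fun x => spans g (rem x s) && ~~ (g %| n%:Z * x - sg)%Z) s).
  by exists x.
have gP x : x \in s -> spans g (rem x s) -> (g %| n%:Z * x - sg)%Z.
  by move=> sx gx; have := all_z x sx; rewrite gx negbK.
(* If the terms other than [x] were all congruent to [x0] modulo [p], the vanishing at [x0] would
   force [x] to be congruent to [x0] as well. *)
have all_spans x : x \in s -> spans g (rem x s).
  move=> sx; apply/negPn/negP => ngx.
  have /(spansPn _ g_gt0)[p [p_pr pg pP]] := ngx.
  have nx0x : x0 != x by apply: contraNneq ngx => <-.
  have rx0 : x0 \in rem x s by rewrite rem_mem.
  have rP y : y \in rem x s -> (p %| y - x0)%Z by move=> ry; apply: pP.
  apply: (@spans_not_const g p x0 s) => // y.
  rewrite (perm_mem (perm_to_rem sx)) inE => /predU1P[->|/rP//].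
  have p1 : (p %| n%:Z * x0 - sg)%Z.
    by apply: dvdz_trans (gP x0 sx0 gx0); rewrite dvdzE.
  have p2 := sum_const rP.
  have -> : x - x0 = - (n%:Z * x0 - sg) -
      (\sum_(y <- rem x s) y - (size (rem x s))%:Z * x0).
    rewrite /sg /n (perm_big _ (perm_to_rem sx)) (perm_size (perm_to_rem sx)) /=.
    by rewrite big_cons intS; ring.
  by rewrite rpredB ?rpredN.
(* Now [g] divides [n * (x - x0)] for every term [x], so [t = g / gcd(g, n)] divides [x - x0]; and
   [t > 1] since [g] does not divide [n]. *)
have d_gt0 : (0 < gcdn g n)%N by rewrite gcdn_gt0 g_gt0.
pose t := (g %/ gcdn g n)%N; pose u := (n %/ gcdn g n)%N.
have gE : g = (t * gcdn g n)%N by rewrite divnK ?dvdn_gcdl.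
have nE : n = (u * gcdn g n)%N by rewrite divnK ?dvdn_gcdr.
have tu : coprime t u.
  by rewrite /coprime -(eqn_pmul2r d_gt0) muln_gcdl -gE -nE mul1n.
have t_gt1 : (1 < t)%N.
  rewrite ltn_neqAle divn_gt0 // dvdn_leq ?dvdn_gcdl // andbT.
  apply: contra ngn => /eqP t1; apply/gcdn_idPl.
  by rewrite [RHS]gE -t1 mul1n.
have [p p_pr pt] := pdivP t_gt1.
exfalso; apply: (@spans_not_const g p x0 s) => //.
  by rewrite gE dvdn_mulr.
move=> x sx.
have : (g %| n%:Z * (x - x0))%Z.
  have -> : n%:Z * (x - x0) = (n%:Z * x - sg) - (n%:Z * x0 - sg) by ring.
  by rewrite rpredB ?gP ?all_spans.
rewrite !dvdzE abszM /= [X in (X %| _)%N -> _]gE [X in (_ %| X * _)%N -> _]nE.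
rewrite mulnAC dvdn_pmul2r // Gauss_dvdr //.
exact: dvdn_trans.
Qed.

(* n if n < g, g - 1 if n = g, and g if n > g. *)
Definition nsums_min (n g : nat) : nat := (minn n g - (n == g))%N.

(** Both sides are [g - 1] when [n = g], and [g] when [n] is a larger multiple. This settles the
    case excluded from [exists_removable]. *)
Lemma nsums_min_dvd n g : (1 < g)%N -> (0 < n)%N -> (g %| n)%N ->
  (nsums_min n g <= nsums_min n.-1 g)%N.
Proof.
move=> g_gt1 n_gt0 /dvdnP[k nE]; rewrite /nsums_min.
have : (n = g \/ g.+1 < n)%N.
  case: k nE => [|[|k]] nE; [lia | left; lia | right; nia].
case=> ?; lia.
Qed.

Lemma nsums_min_pred n g : (nsums_min n g <= (nsums_min n.-1 g).+1)%N.
Proof. rewrite /nsums_min; lia. Qed.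

(** The delicate case is [n = h], where one value is lost in the quotient: there
    [e * (n - 1) >= 2 * (n - 1) >= n]. *)
Lemma nsums_min_mul n e h : (1 < e)%N -> (0 < h)%N -> (1 < n)%N ->
  (nsums_min n (e * h) <= e * nsums_min n h)%N.
Proof.
move=> e1 h0 n1; rewrite /nsums_min.
apply: leq_trans (leq_subr _ _) _.
case: (ltngtP n h) => [lt_nh|lt_hn|nh]; rewrite ?subn0.
- by rewrite (leq_trans (geq_minl _ _)) // leq_pmull // ltnW.
- exact: geq_minr.
- apply: leq_trans (geq_minl _ _) _; apply: (@leq_trans (2 * (n - 1))).
    lia.
  by rewrite leq_mul2r e1 orbT.
Qed.

(* Distinct terms are singled out by distinct primes, so one of these primes is
   at least the number of terms; inserting its term at each position then gives
   pairwise distinct sums. *)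
Lemma all_critical (g : nat) (s : seq int) : (0 < g)%N -> (1 < size s)%N -> spans g s ->
  (forall x, x \in s -> ~~ spans g (rem x s)) -> (size s <= nsums g s)%N.
Proof.
move=> g_gt0 s_gt1 gs crit.
pose const (p : nat) t := all (fun y => all (fun z => (p %| y - z)%Z) t) t.
(* A prime modulo which the terms other than [x] agree; the default 0 is never reached for [x] in
   [s]. *)
pose q x := head 0%N [seq p <- primes g | const p (rem x s)].
have qP x : x \in s -> [/\ prime (q x), (q x %| g)%N &
    forall y z, y \in rem x s -> z \in rem x s -> (q x %| y - z)%Z].
  move=> sx; have : q x \in [seq p <- primes g | const p (rem x s)].
    have /(spansPn _ g_gt0)[p [p_pr pg pP]] := crit x sx.
    have : p \in [seq p <- primes g | const p (rem x s)].
      rewrite mem_filter mem_primes p_pr g_gt0 pg !andbT.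
      by apply/allP => y ry; apply/allP => z rz; apply: pP.
    by rewrite /q; case: filter => //= *; apply: mem_head.
  rewrite mem_filter mem_primes => /and4P[/allP cP -> _ ->]; split=> // y z ry rz.
  by have /allP := cP y ry; apply.
have nP x a : x \in s -> a \in rem x s -> ~~ (q x %| x - a)%Z.
  move=> sx ra; have [q_pr qg rP] := qP x sx.
  apply/negP => qxa; apply: (@spans_not_const g (q x) a s) => // y.
  by rewrite (perm_mem (perm_to_rem sx)) inE => /predU1P[->//|/rP]; apply.
have [/hasP[x sx le_sq]|/hasPn lt_qs] := boolP (has (fun x => size s <= q x)%N s).
  have [q_pr qg rP] := qP x sx.
  have /perm_size := perm_to_rem sx; rewrite /= => sE.
  have [a ra] : exists a, a \in rem x s.
    by move: s_gt1; rewrite sE; case: (rem x s) => // a r _; exists a; apply: mem_head.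
  rewrite (nsums_perm g (perm_to_rem sx)) sE (@nsums_insert g (q x) x a) ?nP //;
    last first.
    by move=> y /rP; apply.
  by rewrite -ltnS -sE ltnS.
have rem_notin x : x \in s -> x \notin rem x s.
  by move=> sx; apply/negP => /(nP x x sx); rewrite subrr dvdz0.
have s_uniq : uniq s.
  apply: count_mem_uniq => x; case: (boolP (x \in s)) => [sx|/count_memPn//].
  rewrite (seq.permP (perm_to_rem sx)) /= eqxx.
  by have /count_memPn -> := rem_notin x sx.
(* If [q x = q y], a third term [z] is congruent to [x] modulo [q y], which [nP] forbids modulo
   [q x]. It exists because [size s > q x >= 2]. *)
have q_inj : {in s &, injective q}.
  move=> x y sx sy qxy; apply/eqP/negPn/negP => nxy.
  have rxy : y \in rem x s by rewrite rem_mem // eq_sym.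
  have ryx : x \in rem y s by rewrite rem_mem.
  have := lt_qs x sx; rewrite -ltnNge => q_lt.
  have [q_pr qg rxP] := qP x sx; have [_ _ ryP] := qP y sy.
  have [z rz] : exists z, z \in rem y (rem x s).
    have := perm_size (perm_to_rem rxy); have := perm_size (perm_to_rem sx).
    have := prime_gt1 q_pr; case: (rem y _) => [|z r] /=; first by lia.
    by exists z; apply: mem_head.
  have := rz; rewrite mem_rem_uniq ?rem_uniq // inE => /andP[nzy].
  rewrite mem_rem_uniq // inE => /andP[nzx sz].
  have rzx : z \in rem x s by rewrite rem_mem.
  have rzy : z \in rem y s by rewrite rem_mem.
  by have := nP x z sx rzx; rewrite qxy ryP.
(* Too many distinct primes for the interval from 2 to [size s - 1]. *)
have : (size (map q s) <= size (iota 2 (size s - 2)))%N.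
  apply: uniq_leq_size; first by rewrite map_inj_in_uniq.
  move=> _ /mapP[x sx ->]; rewrite mem_iota subnKC //.
  have [q_pr _ _] := qP x sx.
  by rewrite prime_gt1 //= ltnNge lt_qs.
by rewrite size_map size_iota leqNgt ltn_subrL (ltnW s_gt1).
Qed.

Theorem nsums_bound (g : nat) (s : seq int) : (0 < g)%N -> spans g s ->
  (nsums_min (size s) g <= nsums g s)%N.
Proof.
(* Induction on [size s + g]: removing a term lowers the size, and passing to a period lowers the
   modulus. *)
move: {2}(size s + g)%N (leqnn (size s + g)%N) => N.
elim: N g s => [|N IHN] g s leN g_gt0 gs; first by lia.
have om1 := nsums_gt0 s g_gt0.
have [g_le1|g_gt1] := leqP g 1; first by move: om1; rewrite /nsums_min; lia.
have [n_le1|n_gt1] := leqP (size s) 1; first by move: om1; rewrite /nsums_min; lia.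
have [/hasP[x0 sx0 gx0]|/hasPn crit] :=
  boolP (has (fun x => spans g (rem x s)) s); last first.
  by apply: leq_trans (all_critical g_gt0 n_gt1 gs crit); rewrite /nsums_min; lia.
have IHrem x : x \in s -> spans g (rem x s) ->
    (nsums_min (size s).-1 g <= nsums g (rem x s))%N.
  move=> sx gx; rewrite -(size_rem sx); apply: IHN => //.
  by rewrite (size_rem sx) -ltnS (leq_trans _ leN) // -addSn prednK // ltnW.
have [gn|ngn] := boolP (g %| size s)%N.
  apply: leq_trans (nsums_min_dvd g_gt1 (ltnW n_gt1) gn) _.
  apply: leq_trans (IHrem _ sx0 gx0) _.
  by rewrite (nsums_perm g (perm_to_rem sx0)) nsums_cons.
have [x [sx gx nz]] := exists_removable g_gt0 gs sx0 gx0 ngn.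
have sE := perm_to_rem sx.
have := @nsums_step g x (rem x s) g_gt0.
rewrite -(nsums_perm g sE).
case=> [lt_om|].
  by apply: leq_trans (nsums_min_pred _ _) (leq_ltn_trans (IHrem _ sx gx) lt_om).
set z := _ - _ => zP.
have zE : z = (size s)%:Z * x - \sum_(y <- s) y.
  by rewrite (perm_big _ sE) (perm_size sE) /= big_cons intS /z; ring.
have {}zP : periodic z (attains g s).
  by move=> c; rewrite !(attains_perm g sE) zP.
(* Both [z] and [g] are periods, hence so is their gcd, a proper divisor of [g] because [g] does not
   divide [z]. *)
pose h := gcdn `|z| g.
have hP : periodic h (attains g s).
  by have := periodic_gcd zP (@attains_periodic g s).
have hg : (h %| g)%N by apply: dvdn_gcdr.
have h_gt0 : (0 < h)%N by rewrite gcdn_gt0 g_gt0 orbT.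
have h_lt : (h < g)%N.
  rewrite ltn_neqAle dvdn_leq // andbT; apply: contra nz => /eqP hE.
  by rewrite -zE dvdzE /= -[X in (X %| _)%N]hE dvdn_gcdl.
rewrite (nsums_periodic g_gt0 hg hP).
have e_gt1 : (1 < g %/ h)%N by rewrite ltn_divRL // mul1n.
have le1 := nsums_min_mul e_gt1 h_gt0 n_gt1.
rewrite divnK // in le1; apply: leq_trans le1 _.
rewrite leq_mul2l IHN ?orbT //; first by lia.
exact: spans_dvd gs.
Qed.

(** * Reaching prescribed sums, with one or two sequences *)

Lemma nresidues_full (g : nat) (P : pred int) : (0 < g)%N -> periodic g P ->
  (g <= nresidues g P)%N -> forall c, P c.
Proof.
move=> g_gt0 gP leP c.
by rewrite -(@nresidues_eq g P predT) // (leq_trans (nresidues_max _ _)).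
Qed.

Lemma nresidues_pair (g : nat) (P : pred int) (c d : int) : (0 < g)%N ->
  periodic g P -> (g.-1 <= nresidues g P)%N -> ~~ (g %| c - d)%Z -> P c || P d.
Proof.
move=> g_gt0 gP leP ncd; apply/negPn/negP; rewrite negb_or => /andP[nPc nPd].
have: (2 <= nresidues g (predC P))%N.
  apply: (@nresidues_uniq g (predC P) [:: c; d]) => //=; last by rewrite ncd.
    by move=> e /=; rewrite gP.
  by rewrite nPc nPd.
have := count_predC (fun i : nat => P i%:Z) (iota 0 g).
rewrite size_iota -nresiduesE => gE le2.
have : count (predC (fun i : nat => P i%:Z)) (iota 0 g) = nresidues g (predC P).
  by rewrite nresiduesE.
lia.
Qed.

(** Take for [d] the gcd of [g] and all [x - a]. If the quotients agreed modulo a prime [p] dividing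
    [g / d], they would vanish modulo [p], as the one at [a] does, and [p * d] would divide [d]. *)
Lemma exists_hull (g : nat) (s : seq int) (a : int) : (0 < g)%N -> a \in s ->
  exists d : nat, [/\ (d %| g)%N, forall x, x \in s -> (d %| x - a)%Z
    & spans (g %/ d) [seq ((x - a) %/ d)%Z | x <- s]].
Proof.
move=> g_gt0 sa; pose d := foldr (fun x e => gcdn `|(x - a)%R| e) g s.
have dP (e : nat) : (e %| d)%N = (e %| g)%N && all (fun x => (e %| x - a)%Z) s.
  rewrite /d; elim: (s) => [|x r IHr] /=; first by rewrite andbT.
  by rewrite dvdn_gcd IHr andbCA dvdzE.
have := dvdnn d; rewrite dP => /andP[dg /allP ds].
have d_gt0 := dvdn_gt0 g_gt0 dg.
exists d; split=> //; apply/negPn/negP.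
have gd_gt0 : (0 < g %/ d)%N by rewrite divn_gt0 // dvdn_leq.
case/(spansPn _ gd_gt0) => p [p_pr pgd pP].
have : (p * d %| d)%N.
  rewrite dP -dvdn_divRL // pgd; apply/allP => x sx.
  have /(pP _ _ (map_f _ sx)) := map_f (fun x => ((x - a) %/ d)%Z) sa.
  rewrite subrr div0z subr0 => /dvdzP[k kE].
  by rewrite -(divzK (ds x sx)) kE -mulrA dvdz_mull.
move=> /(dvdn_leq d_gt0); rewrite -[X in (_ <= X)%N]mul1n leq_pmul2r //.
by rewrite leqNgt prime_gt1.
Qed.

(** There are more than [g / d] quotients, so by [nsums_bound] their sums cover all residues modulo
    [g / d]. *)
Lemma attains_coset (g d : nat) (s : seq int) (a c : int) :
  (0 < g)%N -> (d %| g)%N -> (forall x, x \in s -> (d %| x - a)%Z) ->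
  spans (g %/ d) [seq ((x - a) %/ d)%Z | x <- s] ->
  (g %/ d < size s)%N -> (d %| c)%Z ->
  attains g s (a * wsum 0 (nseq (size s) 1) + c).
Proof.
move=> g_gt0 dg ds span_s lt_s /dvdzP[k ->].
have d_gt0 := dvdn_gt0 g_gt0 dg.
set s' := map _ s in span_s.
have gd_gt0 : (0 < g %/ d)%N by rewrite divn_gt0 // dvdn_leq.
have le_om := nsums_bound gd_gt0 span_s.
rewrite /nsums_min size_map (minn_idPr (ltnW lt_s)) gtn_eqF // subn0 in le_om.
have /attainsP[t ts' tk] :=
  nresidues_full gd_gt0 (@attains_periodic _ _) le_om k.
have s'E : [seq a + d%:Z * y | y <- s'] = s.
  rewrite -map_comp -[RHS]map_id; apply/eq_in_map => x sx /=.
  by rewrite mulrC divzK ?ds // addrC subrK.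
apply/attainsP; exists [seq a + d%:Z * y | y <- t].
  by rewrite -s'E perm_map.
rewrite wsum_affine (perm_size ts') size_map -/s' /=.
have -> : a * wsum 0 (nseq (size s) 1) + d%:Z * wsum 0 t -
  (a * wsum 0 (nseq (size s) 1) + k * d%:Z) = d%:Z * (wsum 0 t - k) by ring.
by rewrite -(divnK dg) mulnC PoszM dvdz_mul.
Qed.

Lemma spans_translate (g : nat) (s : seq int) (a : int) : (0 < g)%N ->
  spans g [seq ((x - a) %/ 1)%Z | x <- s] -> spans g s.
Proof.
move=> g_gt0; apply: contraLR => /(spansPn _ g_gt0)[p [p_pr pg pP]].
apply/spansPn => //; exists p; split=> // _ _ /mapP[x sx ->] /mapP[y sy ->].
rewrite !divz1; have -> : x - a - (y - a) = x - y by ring.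
exact: pP.
Qed.

Lemma wsum1E (s t : seq int) : perm_eq t s ->
  wsum 1 t = wsum 0 t + \sum_(x <- s) x.
Proof. by move=> ts; rewrite -[1]addr0 wsum_shift mul1r (perm_big _ ts) addrC. Qed.

Lemma wsum1_nseq1 n : 2 * wsum 1 (nseq n 1) = n%:Z * n.+1%:Z.
Proof. by rewrite wsum_nseq1 intS; ring. Qed.

(** Exchanging the first two terms of the second sequence shifts its sum by a nonzero residue, and
    the sums of [s1] miss at most one of the two resulting targets. *)
Lemma sum_two_full (q : nat) (s1 s2 : seq int) (a v : int) : (0 < q)%N ->
  (q.-1 <= nsums q s1)%N -> ~~ (q %| v - a)%Z ->
  exists t1 t2, [/\ perm_eq t1 s1, perm_eq t2 (a :: v :: s2)
    & (q %| wsum 1 t1 + wsum 1 t2)%Z].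
Proof.
move=> q_gt0 le_om nva.
set sg := \sum_(x <- s1) x.
have fin t2 : perm_eq t2 (a :: v :: s2) -> attains q s1 (- sg - wsum 1 t2) ->
    exists t1 t2, [/\ perm_eq t1 s1, perm_eq t2 (a :: v :: s2)
      & (q %| wsum 1 t1 + wsum 1 t2)%Z].
  move=> t2P /attainsP[t1 t1P qt]; exists t1, t2; split=> //.
  rewrite (wsum1E t1P) -/sg.
  by have -> : wsum 0 t1 + sg + wsum 1 t2 = wsum 0 t1 - (- sg - wsum 1 t2) by ring.
have vaP : perm_eq (v :: a :: s2) (a :: v :: s2).
  by apply/seq.permP => p /=; rewrite addnCA.
set c1 := - sg - wsum 1 (v :: a :: s2).
pose c2 := - sg - wsum 1 (a :: v :: s2).
have nc : ~~ (q %| c1 - c2)%Z.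
  by have -> : c1 - c2 = v - a by rewrite /c1 /c2 /=; ring.
have := nresidues_pair q_gt0 (@attains_periodic q s1) le_om nc.
by case/orP => [/(fin _ vaP)|/(fin _ (perm_refl _))].
Qed.

(** Since [d >= 2] and [q > 2], the [q - 1] terms outnumber [q / d], so every sum in the coset is
    reached, that of the constant sequence [a] included. *)
Lemma attains_proper_coset (q d : nat) (s : seq int) (a : int) : (2 < q)%N ->
  size s = q.-1 -> (d %| q)%N -> (1 < d)%N ->
  (forall x, x \in s -> (d %| x - a)%Z) ->
  spans (q %/ d) [seq ((x - a) %/ d)%Z | x <- s] ->
  exists2 t, perm_eq t s & (q %| wsum 1 t - a * wsum 1 (nseq q.-1 1))%Z.
Proof.
move=> q_gt2 sE dq d_gt1 ds span_s; have q_gt0 : (0 < q)%N by lia.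
have lt_s : (q %/ d < size s)%N by rewrite sE; have := divnK dq; nia.
pose c := (size s)%:Z * a - \sum_(x <- s) x.
have dc : (d %| c)%Z by rewrite -rpredN opprB sum_const.
have /attainsP[t ts qt] := attains_coset q_gt0 dq ds span_s lt_s dc.
exists t => //; rewrite (wsum1E ts) -[X in _ * wsum X _](addr0 1) wsum_shift.
have ones n : \sum_(x <- nseq n (1 : int)) x = n%:Z.
  by elim: n => [|n IHn]; rewrite /= ?big_nil // big_cons IHn intS.
rewrite ones mul1r -sE.
move: qt; set W := wsum 0 (nseq _ _).
have -> // : wsum 0 t - (a * W + c) =
  wsum 0 t + \sum_(x <- s) x - a * ((size s)%:Z + W).
by rewrite /c; ring.
Qed.

(** If one half generates [Z_q], it attains at least [q - 1] sums and [sum_two_full] applies.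
    Otherwise each half reaches the sum of its constant sequence, and these two cancel since
    [2 * W = (q - 1) * q]. *)
Lemma sum_two (q : nat) (s1 s2 : seq int) (a1 a2 u v : int) : (2 < q)%N ->
  size s1 = (q - 3)%N -> size s2 = (q - 3)%N -> (q %| a1 - a2)%Z ->
  ~~ (q %| u - a1)%Z -> ~~ (q %| v - a2)%Z ->
  exists t1 t2, [/\ perm_eq t1 (a1 :: u :: s1), perm_eq t2 (a2 :: v :: s2)
    & (q %| wsum 1 t1 + wsum 1 t2)%Z].
Proof.
move=> q_gt2 s1E s2E qa nua nva; have q_gt0 : (0 < q)%N by lia.
have [d1 [d1q d1s span1]] := exists_hull q_gt0 (mem_head a1 (u :: s1)).
have [d2 [d2q d2s span2]] := exists_hull q_gt0 (mem_head a2 (v :: s2)).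
have le_om a w s : size s = (q - 3)%N ->
    spans (q %/ 1) [seq ((x - a) %/ 1)%Z | x <- a :: w :: s] ->
    (q.-1 <= nsums q (a :: w :: s))%N.
  move=> sE; rewrite divn1 => /(spans_translate q_gt0)/(nsums_bound q_gt0).
  by apply: leq_trans; rewrite /nsums_min /= sE; lia.
have [d1_gt1|d1_le1] := ltnP 1 d1; last first.
  have d1E : d1 = 1%N by have := dvdn_gt0 q_gt0 d1q; lia.
  by rewrite d1E in span1; apply: sum_two_full (le_om _ _ _ s1E span1) nva.
have [d2_gt1|d2_le1] := ltnP 1 d2; last first.
  have d2E : d2 = 1%N by have := dvdn_gt0 q_gt0 d2q; lia.
  rewrite d2E in span2.
  have [t2 [t1 [t2P t1P qt]]] := sum_two_full s1 q_gt0 (le_om _ _ _ s2E span2) nua.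
  by exists t1, t2; split; rewrite // addrC.
have size1 : size (a1 :: u :: s1) = q.-1 by rewrite /= s1E; lia.
have size2 : size (a2 :: v :: s2) = q.-1 by rewrite /= s2E; lia.
have [t1 t1P q1] := attains_proper_coset q_gt2 size1 d1q d1_gt1 d1s span1.
have [t2 t2P q2] := attains_proper_coset q_gt2 size2 d2q d2_gt1 d2s span2.
exists t1, t2; split=> //; move: q1 q2; set W := wsum 1 (nseq _ _) => q1 q2.
have W2 : 2 * W = (q%:Z - 1) * q%:Z.
  by rewrite wsum1_nseq1 prednK //; congr (_ * _); clear -q_gt0; lia.
have -> : wsum 1 t1 + wsum 1 t2 = (wsum 1 t1 - a1 * W) + (wsum 1 t2 - a2 * W)
  + a2 * (2 * W) + (a1 - a2) * W by ring.
rewrite W2; apply: rpredD; last exact: dvdz_mulr.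
by apply: rpredD; [apply: rpredD | rewrite mulrA dvdz_mull].
Qed.

(** * From modulus [q] to modulus [2q] by exchanging two terms *)

Lemma count_take_drop (p : pred int) n (s : seq int) :
  (count p (take n s) + count p (drop n s))%N = count p s.
Proof. by rewrite -count_cat cat_take_drop. Qed.

(** For [2q] terms, the weights 0, ..., 2q - 1 stand for 1, ..., 2q, the weight [2q] being 0 modulo
    [2q]. *)
Definition solvable (q : nat) (s : seq int) :=
  exists2 t, perm_eq t s & ((2 * q)%N %| wsum 0 t)%Z.

Lemma solvable_perm q s t : perm_eq s t -> solvable q s -> solvable q t.
Proof. by move=> st [r rs qr]; exists r => //; apply: perm_trans st. Qed.

(* Exchanging two terms changes the sum by an odd multiple of q, so it is
   enough to reach 0 modulo q. *)
Lemma solvable_swap (q : nat) (s t1 t2 : seq int) (k : int) : (0 < q)%N ->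
  perm_eq t1 s -> perm_eq t2 s -> (q %| wsum 0 t1)%Z ->
  wsum 0 t2 - wsum 0 t1 = q%:Z * k -> ~~ (2 %| k)%Z -> solvable q s.
Proof.
move=> q_gt0 t1s t2s /dvdzP[l lE] kE k_odd.
have t2E : wsum 0 t2 = (l + k) * q%:Z.
  by rewrite -(subrK (wsum 0 t1) (wsum 0 t2)) kE lE; ring.
have [l_even|l_odd] := boolP (2 %| l)%Z.
  by exists t1; rewrite // lE PoszM dvdz_mul.
by exists t2; rewrite // t2E PoszM dvdz_mul //; lia.
Qed.

(** The terms [x] and [y] get the weights 0 and [q]; those of [t2], starting at [q + 1], count
    modulo [q] as if starting at 1. *)
Lemma solvable_pair (q : nat) (x y : int) (t1 t2 : seq int) : (0 < q)%N ->
  size t1 = q.-1 -> ~~ (2 %| x - y)%Z -> (q %| wsum 1 t1 + wsum 1 t2)%Z ->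
  solvable q (x :: y :: t1 ++ t2).
Proof.
move=> q_gt0 t1E xy qt.
have wE u w : wsum 0 (u :: t1 ++ w :: t2) =
    (wsum 1 t1 + wsum 1 t2) + q%:Z * (w + \sum_(z <- t2) z).
  rewrite /= mul0r !add0r wsum_cat /= t1E.
  have -> : 1 + q.-1%:Z = q%:Z + 0 by lia.
  by rewrite -addrA wsum_shift !addr0 add0r addrA; ring.
apply: (@solvable_swap q _ (x :: t1 ++ y :: t2) (y :: t1 ++ x :: t2) (x - y)) => //.
- by apply/seq.permP => p; rewrite /= !count_cat /=; count_lia.
- by apply/seq.permP => p; rewrite /= !count_cat /=; count_lia.
- by rewrite wE rpredD // dvdz_mulr.
by rewrite !wE; ring.
Qed.

Lemma solvable_two (q : nat) (x y a1 a2 u v : int) (r : seq int) : (2 < q)%N ->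
  size r = (2 * q - 6)%N -> ~~ (2 %| x - y)%Z -> (q %| a1 - a2)%Z ->
  ~~ (q %| u - a1)%Z -> ~~ (q %| v - a2)%Z ->
  solvable q [:: x, y, a1, a2, u, v & r].
Proof.
move=> q_gt2 rE xy qa nua nva.
have size1 : size (take (q - 3) r) = (q - 3)%N by rewrite size_takel ?rE; lia.
have size2 : size (drop (q - 3) r) = (q - 3)%N by rewrite size_drop rE; lia.
have [t1 [t2 [t1P t2P qt]]] := sum_two q_gt2 size1 size2 qa nua nva.
apply: (@solvable_perm q (x :: y :: t1 ++ t2)); last first.
  apply: solvable_pair => //; first by lia.
  by rewrite (perm_size t1P) /= size1; lia.
apply/seq.permP => p; rewrite /= count_cat (seq.permP t1P) (seq.permP t2P) /=.
rewrite -(count_take_drop p (q - 3) r); count_lia.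
Qed.

(** The weight [w = q / gcd(u - a, q)] annihilates [u - a] modulo [q], and the constant part
    vanishes since each weight occurs twice. *)
Lemma solvable_one (q : nat) (x y a u : int) (r : seq int) : (2 < q)%N ->
  size r = (2 * q - 3)%N -> ~~ (2 %| x - y)%Z ->
  (forall z, z \in r -> (q %| z - a)%Z) -> ~~ coprime `|u - a| q ->
  solvable q [:: x, y, u & r].
Proof.
move=> q_gt2 rE xy ra nua; have q_gt0 : (0 < q)%N by lia.
pose d := gcdn `|u - a| q; pose w := (q %/ d)%N.
have dq : (d %| q)%N by apply: dvdn_gcdr.
have d_gt0 : (0 < d)%N := dvdn_gt0 q_gt0 dq.
have wd : (w * d)%N = q by rewrite divnK.
have w_gt0 : (0 < w)%N by rewrite divn_gt0 // dvdn_leq.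
have d_gt1 : (1 < d)%N by move: nua; rewrite /coprime -/d; lia.
have w_lt : (w < q)%N by rewrite -wd; nia.
have qw : (q %| w%:Z * (u - a))%Z by rewrite -wd PoszM dvdz_mul // dvdzE dvdn_gcdl.
set r1 := take (q - 2) r; set r2 := drop (q - 2) r.
have size1 : size r1 = (q - 2)%N by rewrite size_takel ?rE; lia.
have size2 : size r2 = q.-1 by rewrite size_drop rE; lia.
(* Weights start at 1, so [w - 1] terms precede [u]. *)
pose t1 := take w.-1 r1 ++ u :: drop w.-1 r1.
have size3 : size (take w.-1 r1) = w.-1 by rewrite size_takel // size1; lia.
apply: (@solvable_perm q (x :: y :: t1 ++ r2)).
  apply/seq.permP => p; rewrite /t1 /= !count_cat /= -(count_take_drop p (q - 2) r).
  rewrite -/r1 -/r2 -(count_take_drop p w.-1 r1); count_lia.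
apply: solvable_pair => //.
  rewrite /t1 size_cat /= size3 size_drop size1; lia.
have := @wsum_insert q 1 a u (take w.-1 r1) (drop w.-1 r1).
rewrite cat_take_drop size3 size1 -/t1 => /(_ (fun z zr => ra z (mem_take zr))).
have := @wsum_const q 1 a r2 (fun z zr => ra z (mem_drop zr)).
rewrite size2 (_ : (q - 2).+1 = q.-1); last by lia.
set W := wsum 1 (nseq _ _) => q2 q1.
have W2 : 2 * W = (q%:Z - 1) * q%:Z.
  by rewrite wsum1_nseq1 prednK //; congr (_ * _); clear -q_gt0; lia.
have wE : 1 + w.-1%:Z = w%:Z by lia.
rewrite wE in q1.
have -> : wsum 1 t1 + wsum 1 r2 = (wsum 1 t1 - (a * W + w%:Z * (u - a))) +
  (wsum 1 r2 - a * W) + a * (2 * W) + w%:Z * (u - a) by ring.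
rewrite W2; apply: rpredD => //.
by apply: rpredD; [apply: rpredD | rewrite mulrA dvdz_mull].
Qed.

(** * The exceptional family and nearly constant sequences *)

(** With [b = u - a], the last condition says that [v] is [a - b] modulo [2q]. *)
Definition exceptional (q : nat) (s : seq int) :=
  exists a u v r, [/\ perm_eq s [:: u, v & r],
    forall z, z \in r -> ((2 * q)%N %| z - a)%Z, (2 %| a)%Z,
    coprime `|u - a| (2 * q) & ((2 * q)%N %| u + v - 2 * a)%Z].

Lemma exceptional_perm q s t : perm_eq s t -> exceptional q s -> exceptional q t.
Proof.
move=> st [a [u [v [r [sP *]]]]]; exists a, u, v, r; split=> //.
by rewrite perm_sym in st; apply: perm_trans sP.
Qed.

Lemma coprime_ndvd (q : nat) (z : int) : (1 < q)%N -> coprime `|z| q ->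
  ~~ (q %| z)%Z.
Proof.
move=> q_gt1 cz; apply/negP; rewrite dvdzE /= => /gcdn_idPl.
by rewrite gcdnC; move/eqP: cz => ->; lia.
Qed.

Lemma extract3 (q : nat) (s : seq int) (z : int) : (2 < q)%N ->
  size s = (2 * q - 3)%N -> z \in s ->
  exists a b r, perm_eq s [:: z, a, b & r] /\ size r = (2 * q - 6)%N.
Proof.
move=> q_gt2 sE sz; have := perm_size (perm_to_rem sz); rewrite sE /=.
case rE: (rem z s) => [|a [|b r]] /= rs; [lia | lia |].
exists a, b, r; split; last by lia.
by rewrite -rE; apply: perm_to_rem.
Qed.

Lemma double_dvd (q : nat) (c : int) : (0 < q)%N ->
  ((2 * q)%N %| q%:Z * c)%Z = (2 %| c)%Z.
Proof. by move=> q_gt0; rewrite mulnC PoszM dvdz_mul2l //; lia. Qed.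

Lemma solvable_constant (q : nat) (x e y : int) (r : seq int) : (2 < q)%N ->
  size r = (2 * q - 3)%N -> ~~ (2 %| x - y)%Z ->
  (forall z, z \in r -> ((2 * q)%N %| z - y)%Z) ->
  coprime `|e - y| (2 * q) -> coprime `|x - y| (2 * q) ->
  solvable q [:: x, y, e & r] \/ exceptional q [:: x, y, e & r].
Proof.
move=> q_gt2 rE xy ry ce cx; have q_gt0 : (0 < q)%N by lia.
(* For odd [y], give [e] the weight 0 and [x] the weight [q]: the sum is [q] times a number of the
   parity of [x], which is even. *)
have [y_even|y_odd] := boolP (2 %| y)%Z; last first.
  left; pose r' := y :: r.
  have ry' z : z \in r' -> ((2 * q)%N %| z - y)%Z.
    by rewrite inE => /predU1P[->|/ry//]; rewrite subrr dvdz0.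
  exists (e :: take q.-1 r' ++ x :: drop q.-1 r').
    apply/seq.permP => p; rewrite /= count_cat /=.
    have := count_take_drop p q.-1 r'; rewrite /=; count_lia.
  have := @wsum_insert (2 * q)%N 1 y x (take q.-1 r') (drop q.-1 r').
  rewrite cat_take_drop size_takel; last by rewrite /r' /= rE; lia.
  move=> /(_ ry'); set W := wsum 1 (nseq _ _); set E := wsum 1 _ => qE.
  have W2 : 2 * W = (2 * q%:Z - 1) * (2 * q%:Z).
    by rewrite wsum1_nseq1 /= rE; congr (_ * _); clear -q_gt2; lia.
  have WE : W = q%:Z * (2 * q%:Z - 1) by clear -W2; lia.
  have qw : 1 + q.-1%:Z = q%:Z by clear -q_gt0; lia.
  rewrite qw WE in qE.
  rewrite /= mul0r !add0r -/E.
  rewrite -[E](subrK (y * (q%:Z * (2 * q%:Z - 1)) + q%:Z * (x - y))).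
  rewrite rpredD //.
  have -> : y * (q%:Z * (2 * q%:Z - 1)) + q%:Z * (x - y) =
    q%:Z * (2 * (y * q%:Z) + x - 2 * y) by ring.
  rewrite double_dvd //; clear -xy y_odd; lia.
have [exc|nexc] := boolP ((2 * q)%N %| e + x - 2 * y)%Z.
  right; exists y, e, x, (y :: r); split=> //.
    by apply/seq.permP => p /=; count_lia.
  by move=> z; rewrite inE => /predU1P[->|/ry//]; rewrite subrr dvdz0.
left.
have m0 : (2 * q)%N%:Z != 0 by lia.
have [[u v] /= uv] := coprimezP (x - y) (2 * q)%N cx.
(* With [e] at weight 1, this is the weight of [x] that cancels the deviations from [y], [u] being
   an inverse of [x - y]. It is not 0 because [e - y] is a unit, and not 1 outside the exceptional
   family. *)
pose J := ((- (e - y) * u) %% (2 * q)%N)%Z.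
have J_ge0 : 0 <= J by apply: modz_ge0.
have J_lt : J < (2 * q)%N%:Z by apply: ltz_pmod; lia.
have JP : ((2 * q)%N %| (e - y) + J * (x - y))%Z.
  have -> : J = - (e - y) * u - (- (e - y) * u %/ (2 * q)%N)%Z * (2 * q)%N.
    by rewrite [X in _ = X - _](divz_eq _ (2 * q)%N) addrC addKr.
  set l := divz _ _.
  have -> : e - y + (- (e - y) * u - l * (2 * q)%N%:Z) * (x - y) =
    (e - y) * (1 - u * (x - y)) - l * (x - y) * (2 * q)%N%:Z by ring.
  have -> : 1 - u * (x - y) = v * (2 * q)%N%:Z by rewrite -uv; ring.
  by rewrite mulrA -mulrBl dvdz_mull.
have [j jE] : exists j : nat, J = j%:Z by exists `|J|%N; rewrite gez0_abs.
rewrite jE in J_lt JP.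
have j0 : j <> 0%N.
  move=> j0; move: JP; rewrite j0 mul0r addr0.
  by apply/negP; apply: coprime_ndvd ce; lia.
have j1 : j <> 1%N.
  move=> j1; move: JP nexc; rewrite j1 mul1r => JP /negP; apply.
  by have -> : e + x - 2 * y = e - y + (x - y) by ring.
have j_ge2 : (1 < j)%N by lia.
(* The weights 0 and 1 are taken, so [x] comes after [j - 2] terms of [r]. The constant part
   vanishes because [y] is even. *)
exists (y :: e :: take (j - 2) r ++ x :: drop (j - 2) r).
  apply/seq.permP => p; rewrite /= count_cat /=.
  have := count_take_drop p (j - 2) r; count_lia.
have := @wsum_insert (2 * q)%N 2 y x (take (j - 2) r) (drop (j - 2) r).
rewrite cat_take_drop size_takel; last by rewrite rE; lia.
move=> /(_ ry); set W := wsum 2 (nseq _ _); set E := wsum 2 _ => qE.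
have W2 : 2 * W = (2 * q%:Z - 2) * (2 * q%:Z + 1).
  by rewrite wsum_nseq1 rE; congr (_ * _); clear -q_gt2; lia.
have jE2 : 2 + (j - 2)%N%:Z = j%:Z by clear -j_ge2; lia.
rewrite jE2 in qE.
have /dvdzP[y' yE] := y_even.
rewrite /= mul0r !add0r mul1r.
have -> : 1 + 1 = 2 :> int by [].
rewrite -/E.
have -> : e + E = (E - (y * W + j%:Z * (x - y))) + (e - y + j%:Z * (x - y)) +
    (y' * (2 * q%:Z - 1)) * (2 * q)%N%:Z.
  have -> : y * W = y' * (2 * W) by rewrite yE; ring.
  by rewrite W2 yE PoszM; ring.
by apply: rpredD; [apply: rpredD | apply: dvdz_mull].
Qed.

Lemma solvable_nearly_constant (q : nat) (a x y e : int) (r : seq int) :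
  (2 < q)%N -> size r = (2 * q - 3)%N -> (forall z, z \in r -> (q %| z - a)%Z) ->
  ~~ (2 %| x - y)%Z -> ~~ (2 %| e - y)%Z ->
  solvable q [:: x, y, e & r] \/ exceptional q [:: x, y, e & r].
Proof.
move=> q_gt2 rE ra xy ey; have q_gt0 : (0 < q)%N by lia.
have ye : ~~ (2 %| y - e)%Z by lia.
have sub_r u v : u \in r -> v \in r -> (q %| u - v)%Z.
  move=> ru rv; have -> : u - v = (u - a) - (v - a) by ring.
  by rewrite rpredB ?ra.
have [cx|ncx] := boolP (coprime `|x - a| q); last first.
  left; apply: (@solvable_perm q [:: y, e, x & r]); last exact: solvable_one ncx.
  by apply/seq.permP => p /=; count_lia.
have [ce|nce] := boolP (coprime `|e - a| q); last first.
  by left; apply: solvable_one nce.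
have nx z : z \in r -> ~~ (q %| x - z)%Z.
  move=> rz; have := coprime_ndvd (ltnW q_gt2) cx; apply: contra => qx.
  have -> : x - a = (x - z) + (z - a) by ring.
  by rewrite rpredD ?ra.
have ne z : z \in r -> ~~ (q %| e - z)%Z.
  move=> rz; have := coprime_ndvd (ltnW q_gt2) ce; apply: contra => qe.
  have -> : e - a = (e - z) + (z - a) by ring.
  by rewrite rpredD ?ra.
have ext z : z \in r -> exists b c t, [/\ perm_eq r [:: z, b, c & t],
    b \in r, c \in r & size t = (2 * q - 6)%N].
  move=> rz; have [b [c [t [rP tE]]]] := extract3 q_gt2 rE rz.
  by exists b, c, t; rewrite !(perm_mem rP) !inE !eqxx !orbT.
(* A term [z] of [r] of parity opposite to [y] can form the exchanged pair with [y]; [x] and [e]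
   then make the two halves nonconstant. *)
have [/hasP[z rz zy]|/hasPn r_par] := boolP (has (fun z : int => ~~ (2 %| z - y)%Z) r).
  left; have [b [c [t [rP rb rc tE]]]] := ext z rz.
  apply: (@solvable_perm q [:: z, y, b, c, x, e & t]).
    by apply/seq.permP => p; rewrite /= (seq.permP rP) /=; count_lia.
  by apply: solvable_two => //; [apply: sub_r | apply: nx | apply: ne].
have [w rw] : exists w, w \in r.
  case: r rE {ra sub_r nx ne ext r_par} => [|w r] rE.
    by move: rE => /=; lia.
  by exists w; apply: mem_head.
have r_even z : z \in r -> (2 %| z - y)%Z by move/r_par; rewrite negbK.
(* Otherwise [x] and any term of [r] have opposite parities, and [y] and [e] can serve in the two
   halves if [y] is not [a] modulo [q]. *)
have [qya|nqya] := boolP (q %| y - a)%Z; last first.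
  left; have [b [c [t [rP rb rc tE]]]] := ext w rw.
  apply: (@solvable_perm q [:: x, w, b, c, y, e & t]).
    by apply/seq.permP => p; rewrite /= (seq.permP rP) /=; count_lia.
  apply: solvable_two => //; [ | exact: sub_r | | exact: ne].
    by have := r_even w rw; lia.
  apply: contra nqya => qyb; have -> : y - a = (y - b) + (b - a) by ring.
  by rewrite rpredD ?ra.
have ry z : z \in r -> (q %| z - y)%Z.
  move=> rz; have -> : z - y = (z - a) - (y - a) by ring.
  by rewrite rpredB // ra.
have [/hasP[z rz nzy]|/hasPn r_const] :=
  boolP (has (fun z : int => ~~ ((2 * q)%N %| z - y)%Z) r); last first.
  have cop u : coprime `|u - a| q -> ~~ (2 %| u - y)%Z ->
      coprime `|u - y| (2 * q).
    move=> cu uy; rewrite coprimeMr coprimen2.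
    have -> : odd `|u - y| by lia.
    have /dvdzP[k kE] := qya.
    have -> : u - y = (- k) * q%:Z + (u - a) by rewrite mulNr -kE; ring.
    rewrite -[coprime _ q]/(coprimez _ q%:Z) coprimez_sym.
    by rewrite /coprimez gcdzMDl -/(coprimez _ _) coprimez_sym.
  apply: solvable_constant => //; [ | exact: cop | exact: cop].
  by move=> z /r_const; rewrite negbK.
(* Here [z - y] is an odd multiple of [q]: exchanging [z] and [y] at the weights 1 and 2 replaces
   the parity exchange, with [e] at weight 0 and [x] at weight [q], where neither matters modulo
   [q]. *)
left; have /dvdzP[k kE] := ry z rz.
have k_odd : ~~ (2 %| k)%Z by move: nzy; rewrite kE mulrC double_dvd.
have rP := perm_to_rem rz; set t := rem z r in rP.
have tE : size t = (2 * q - 4)%N by have := perm_size rP; rewrite rE /=; lia.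
set t1 := take (q - 3) t; set t2 := drop (q - 3) t.
have t1E : size t1 = (q - 3)%N by rewrite size_takel // tE; lia.
have tP p : (count p t1 + count p t2)%N = count p t by apply: count_take_drop.
apply: (@solvable_swap q _ [:: e, z, y & t1 ++ x :: t2]
  [:: e, y, z & t1 ++ x :: t2] k) => //.
- by apply/seq.permP => p; rewrite /= (seq.permP rP) /= count_cat /= -tP;
  count_lia.
- by apply/seq.permP => p; rewrite /= (seq.permP rP) /= count_cat /= -tP;
  count_lia.
- have := @wsum_insert q 1 y x [:: z, y & t1] t2.
  have -> : [:: z, y & t1] ++ t2 = [:: z, y & t] by rewrite /= cat_take_drop.
  set W := wsum 1 (nseq _ _) => qW.
  have /qW : forall u, u \in [:: z, y & t] -> (q %| u - y)%Z.
    move=> u; rewrite !inE => /or3P[/eqP->|/eqP->|tu]; first exact: ry.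
      by rewrite subrr dvdz0.
    by apply: ry; rewrite (mem_rem tu).
  have W2 : 2 * W = (2 * q%:Z - 1) * (2 * q%:Z).
    by rewrite wsum1_nseq1 /= tE; congr (_ * _); clear -q_gt2; lia.
  have -> : W = (2 * q%:Z - 1) * q%:Z by clear -W2; lia.
  have -> : 1 + (size [:: z, y & t1])%:Z = q%:Z by rewrite /= t1E; clear -q_gt2; lia.
  set E := wsum 1 _ => qE.
  have -> : wsum 0 [:: e, z, y & t1 ++ x :: t2] = E by rewrite /E /= mul0r !add0r.
  rewrite -[E](subrK (y * ((2 * q%:Z - 1) * q%:Z) + q%:Z * (x - y))) rpredD //.
  by apply: rpredD; [rewrite mulrA dvdz_mull | rewrite dvdz_mulr].
rewrite /= !add0r !mul0r !mul1r !add0r.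
have -> : z = k * q%:Z + y by rewrite -kE subrK.
ring.
Qed.

(** * Sequences containing both parities *)

Lemma repeated_image (f : int -> int) (s : seq int) : ~~ uniq (map f s) ->
  exists a b r, perm_eq s [:: a, b & r] /\ f a = f b.
Proof.
elim: s => //= x s IHs; rewrite negb_and negbK => /orP[/mapP[y sy fxy]|/IHs].
  by exists x, y, (rem y s); rewrite perm_cons perm_to_rem.
case=> a [b [r [sP fab]]]; exists a, b, (x :: r); split=> //.
by apply/seq.permP => p /=; rewrite (seq.permP sP) /=; count_lia.
Qed.

Lemma solvable_mixed_parity (q : nat) (x y : int) (r : seq int) : (2 < q)%N ->
  size r = (2 * q - 2)%N -> ~~ (2 %| x - y)%Z ->
  solvable q [:: x, y & r] \/ exceptional q [:: x, y & r].
Proof.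
move=> q_gt2 rE xy; have q_gt0 : (0 < q)%N by lia.
(* Pigeonhole: [2q - 2 > q] terms share [q] residues. *)
have [a [b [r' [rP ab]]]] :
  exists a b t, perm_eq r [:: a, b & t] /\ (a %% q)%Z = (b %% q)%Z.
  apply: (repeated_image (f := fun z : int => (z %% q)%Z)).
  apply/negP => r_uniq; have := uniq_leq_size r_uniq (s2 := map Posz (iota 0 q)).
  rewrite !size_map size_iota rE => le_q.
  suff: (2 * q - 2 <= q)%N by lia.
  apply: le_q => _ /mapP[z _ ->].
  have : 0 <= (z %% q)%Z < q%:Z by lia.
  case: (z %% q)%Z => // i i_lt; apply: map_f; rewrite mem_iota; lia.
have qab : (q %| a - b)%Z by rewrite -eqz_mod_dvd; apply/eqP.
have qba : (q %| b - a)%Z by rewrite -rpredN opprB.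
have r'E : size r' = (2 * q - 4)%N by have := perm_size rP; rewrite rE /=; lia.
pose P (z : int) := (q %| z - a)%Z.
have r'P : perm_eq (filter P r' ++ filter (predC P) r') r'.
  by rewrite perm_filterC.
have inP z : z \in filter P r' -> P z by rewrite mem_filter => /andP[].
have notP z : z \in filter (predC P) r' -> ~~ P z by rewrite mem_filter => /andP[].
have notP_b z : ~~ P z -> ~~ (q %| z - b)%Z.
  apply: contra => qzb; rewrite /P; have -> : z - a = (z - b) + (b - a) by ring.
  by rewrite rpredD.
have sizeP := perm_size r'P; rewrite size_cat r'E in sizeP.
move: inP notP r'P sizeP; set t := filter P r'.
(* Three cases, according to whether none, one or at least two of the remaining terms differ from
   [a] modulo [q]. *)
case: (filter _ _) => [|e [|e' u]] inP notP r'P sizeP.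
- left; apply: (@solvable_perm q [:: x, y, b, a & t]).
    by apply/seq.permP => p;
      rewrite /= (seq.permP rP) /= -(seq.permP r'P) count_cat /=; count_lia.
  apply: (@solvable_one q x y a b) => //.
  + by move: sizeP => /=; lia.
  + by move=> z; rewrite inE => /predU1P[->|/inP//]; rewrite subrr dvdz0.
  by apply: contraL qba => cba; apply: coprime_ndvd cba; lia.
- have abt z : z \in [:: a, b & t] -> (q %| z - a)%Z.
    by rewrite !inE => /or3P[/eqP->|/eqP->|/inP//]; rewrite ?subrr ?dvdz0.
  have size_t : size [:: a, b & t] = (2 * q - 3)%N by move: sizeP => /=; lia.
  have sP u v : u = x /\ v = y \/ u = y /\ v = x ->
      perm_eq [:: u, v, e, a, b & t] [:: x, y & r].
    by case=> -[-> ->]; apply/seq.permP => p;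
       rewrite /= (seq.permP rP) /= -(seq.permP r'P) count_cat /=; count_lia.
  have [ey|ney] := boolP (2 %| e - y)%Z.
    have yx : ~~ (2 %| y - x)%Z by lia.
    have ex : ~~ (2 %| e - x)%Z by lia.
    have yxP : perm_eq [:: y, x, e, a, b & t] [:: x, y & r] by apply: sP; right.
    have [] := solvable_nearly_constant q_gt2 size_t abt yx ex.
      by left; apply: solvable_perm yxP _.
    by right; apply: exceptional_perm yxP _.
  have xyP : perm_eq [:: x, y, e, a, b & t] [:: x, y & r] by apply: sP; left.
  have [] := solvable_nearly_constant q_gt2 size_t abt xy ney.
    by left; apply: solvable_perm xyP _.
  by right; apply: exceptional_perm xyP _.
left; apply: (@solvable_perm q [:: x, y, a, b, e, e' & t ++ u]).
  apply/seq.permP => p;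
    rewrite /= (seq.permP rP) /= -(seq.permP r'P) !count_cat /=; count_lia.
apply: solvable_two => //.
- by rewrite size_cat; move: sizeP => /=; lia.
- by apply: notP; rewrite mem_head.
by apply: notP_b; apply: notP; rewrite !inE eqxx orbT.
Qed.

(** Modulo 4, only [u = x] and [v = y + 2] resists, and it is exceptional with [b = y - x]. *)
Lemma solvable_four (x y u v : int) : (2 %| u - x)%Z -> (2 %| v - y)%Z ->
  (2 %| x)%Z -> ~~ (2 %| y)%Z ->
  solvable 2 [:: x; y; u; v] \/ exceptional 2 [:: x; y; u; v].
Proof.
move=> ux vy x_even y_odd.
have solve t : perm_eq t [:: x; y; u; v] -> (4 %| wsum 0 t)%Z ->
    solvable 2 [:: x; y; u; v] by exists t.
have [qux|nqux] := boolP (4 %| u - x)%Z; last first.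
  left; apply: (solve [:: y; x; v; u]); first by apply/seq.permP => p /=; count_lia.
  rewrite /=; lia.
have [qvy|nqvy] := boolP (4 %| v - y)%Z.
  left; apply: (solve [:: x; y; u; v]) => //.
  rewrite /=; lia.
right; exists x, y, v, [:: x; u]; split.
- by apply/seq.permP => p /=; count_lia.
- by move=> z; rewrite !inE => /orP[]/eqP-> //; rewrite subrr dvdz0.
- by [].
- by rewrite (coprimeMr _ 2 2) !coprimen2; lia.
by rewrite /=; lia.
Qed.

Lemma solvable_mixed_parity4 (x y u v : int) : ~~ (2 %| x - y)%Z ->
  solvable 2 [:: x; y; u; v] \/ exceptional 2 [:: x; y; u; v].
Proof.
move=> xy; have [uv|uv] := boolP (2 %| u + v)%Z.
  left; apply: (@solvable_pair 2 x y [:: u] [:: v]) => //=.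
  by rewrite !mul1r !addr0.
have tr s : perm_eq s [:: x; y; u; v] -> solvable 2 s \/ exceptional 2 s ->
    solvable 2 [:: x; y; u; v] \/ exceptional 2 [:: x; y; u; v].
  by move=> sP [/(solvable_perm sP)|/(exceptional_perm sP)]; [left | right].
have [x_even|x_odd] := boolP (2 %| x)%Z; have [u_even|u_odd] := boolP (2 %| u)%Z.
- by apply: solvable_four; lia.
- apply: (tr [:: x; y; v; u]); first by apply/seq.permP => p /=; count_lia.
  by apply: solvable_four; lia.
- apply: (tr [:: y; x; u; v]); first by apply/seq.permP => p /=; count_lia.
  by apply: solvable_four; lia.
- apply: (tr [:: y; x; v; u]); first by apply/seq.permP => p /=; count_lia.
  by apply: solvable_four; lia.
Qed.

(** * Sequences of a single parity, and the result over the integers *)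

(** Writing the terms as [a + 2 * x], the sums of the [x] reach every multiple of their hull [d]
    modulo [q]. For even [a] the multiple 0 suffices; for odd [a] the target is [q / 2]. *)
Lemma solvable_same_parity (q k n : nat) (a : int) (s : seq int) : (0 < q)%N ->
  size s = (2 * q)%N -> (2 * q = 2 ^ k * n)%N -> odd n -> (0 < k)%N -> a \in s ->
  (forall x, x \in s -> (2 %| x - a)%Z) ->
  (~~ (2 %| a)%Z -> exists2 x, x \in s & ~~ ((2 ^ k)%N %| x - a)%Z) ->
  solvable q s.
Proof.
move=> q_gt0 sE qE n_odd k_gt0 sa s_par not_const.
pose s' := [seq ((x - a) %/ 2)%Z | x <- s].
have s'E : [seq a + 2 * x | x <- s'] = s.
  rewrite -map_comp -[RHS]map_id; apply/eq_in_map => x sx /=.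
  by rewrite mulrC divzK ?s_par // addrC subrK.
have s'0 : 0 \in s' by apply/mapP; exists a; rewrite // subrr div0z.
have [d [dq ds span_s]] := exists_hull q_gt0 s'0.
have d_gt0 := dvdn_gt0 q_gt0 dq.
have size_s' : size s' = (2 * q)%N by rewrite size_map.
have lt_qd : (q %/ d < size s')%N.
  by rewrite size_s' (leq_ltn_trans (leq_div q d)) //; lia.
have reach c : (d %| c)%Z -> ((2 * q)%N %| q%:Z * (a * (2 * q%:Z - 1)) + 2 * c)%Z ->
    solvable q s.
  move=> dc qc.
  have /attainsP[t ts' tc] := attains_coset q_gt0 dq ds span_s lt_qd dc.
  exists [seq a + 2 * x | x <- t]; first by rewrite -s'E perm_map.
  rewrite wsum_affine (perm_size ts') size_s'.
  have W2 : 2 * wsum 0 (nseq (2 * q) 1) = (2 * q%:Z) * (2 * q%:Z - 1).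
    by rewrite wsum_nseq1 mulr0 add0r PoszM.
  have -> : a * wsum 0 (nseq (2 * q) 1) + 2 * wsum 0 t =
    (q%:Z * (a * (2 * q%:Z - 1)) + 2 * c) + 2 * (wsum 0 t - c).
    have -> : wsum 0 (nseq (2 * q) 1) = q%:Z * (2 * q%:Z - 1) by clear -W2; lia.
    by ring.
  rewrite rpredD // PoszM dvdz_mul //.
  by move: tc; rewrite mul0r add0r.
have [a_even|a_odd] := boolP (2 %| a)%Z.
  apply: (reach 0); rewrite ?dvdz0 // mulr0 addr0 double_dvd //.
  by rewrite dvdz_mulr.
have [x sx nx] := not_const a_odd.
have [k' kE] : exists k', k = k'.+1 by exists k.-1; rewrite prednK.
have nd : ~~ (2 ^ k' %| d)%N.
  apply: contra nx => kd; rewrite kE expnSr PoszM.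
  rewrite -[x - a](divzK (s_par x sx)) dvdz_mul //.
  have := ds _ (map_f (fun x => ((x - a) %/ 2)%Z) sx); rewrite subr0.
  by apply: dvdz_trans; rewrite dvdzE.
have qE' : q = (2 ^ k' * n)%N by move: qE; rewrite kE expnS -mulnA; lia.
have qd := divnK dq.
(* If [q / d] were odd, [d] would absorb the whole power of 2 in [q], and all terms would agree
   modulo [2 ^ k]. *)
have [e_odd|e_even] := boolP (odd (q %/ d)).
  case/negP: nd; rewrite -(@Gauss_dvdr _ (q %/ d)).
    by rewrite qd qE' dvdn_mulr.
  by case: (k') => [|j]; rewrite ?coprime1n // coprime_pexpl // coprime2n.
pose c := d%:Z * ((q %/ d)./2)%:Z.
have c2 : 2 * c = q%:Z.
  rewrite /c -[in RHS]qd PoszM.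
  have -> : (q %/ d)%N = ((q %/ d)./2).*2 :> nat by rewrite even_halfK.
  rewrite doubleK -mul2n PoszM; ring.
apply: (reach c); first by rewrite dvdz_mulr.
rewrite c2 -[X in _ + X]mulr1 -mulrDr double_dvd //.
have -> : a * (2 * q%:Z - 1) + 1 = 2 * (a * q%:Z) - a + 1 by ring.
clear -a_odd; lia.
Qed.

Theorem solvable_or_exceptional (q k n : nat) (s : seq int) : (0 < q)%N ->
  size s = (2 * q)%N -> (2 * q = 2 ^ k * n)%N -> odd n -> (0 < k)%N ->
  (forall a, ~~ (2 %| a)%Z -> exists2 x, x \in s & ~~ ((2 ^ k)%N %| x - a)%Z) ->
  solvable q s \/ exceptional q s.
Proof.
move=> q_gt0 sE qE n_odd k_gt0 not_const.
case: s => [|a s] in sE not_const *; first by move: sE => /=; lia.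
have [/hasP[y sy ya]|/hasPn same] :=
  boolP (has (fun y : int => ~~ (2 %| y - a)%Z) s); last first.
  left; apply: (solvable_same_parity q_gt0 sE qE n_odd k_gt0 (mem_head a s)).
    by move=> x; rewrite inE => /predU1P[->|/same]; rewrite ?subrr ?dvdz0 ?negbK.
  exact: not_const.
have sP := perm_to_rem sy; set r := rem y s in sP.
have {}sP : perm_eq [:: a, y & r] (a :: s) by rewrite perm_cons perm_sym.
have rE : size r = (2 * q - 2)%N by have := perm_size sP; rewrite sE /=; lia.
have ay : ~~ (2 %| a - y)%Z by lia.
suff [/(solvable_perm sP)|/(exceptional_perm sP)] : solvable q [:: a, y & r] \/
  exceptional q [:: a, y & r] by [left | right].
have [q_gt2|] := ltnP 2 q; first exact: solvable_mixed_parity.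
(* The small moduli are [q = 1], where both halves are empty, and [q = 2], with four terms. *)
case: q q_gt0 sE qE rE {sP} => [|[|[|q]]] // _ _ _ rE _.
- left; have -> : r = [::] ++ [::] by case: (r) rE.
  exact: solvable_pair.
case: r rE => [|u [|v [|w r]]] // _.
exact: solvable_mixed_parity4.
Qed.

(** * Transfer to ['Z_m] *)

Lemma wsumE (n : nat) (w : int) (s : seq int) : size s = n ->
  wsum w s = \sum_(i < n) (w + i%:Z) * s`_i.
Proof.
move=> <- {n}.
elim: s w => [|x s IHs] w /=; first by rewrite big_ord0.
rewrite big_ord_recl /= addr0 IHs; congr (_ + _).
by apply: eq_bigr => i _; rewrite /bump /= intS addrA.
Qed.

Lemma wsum_rcons (w : int) (s : seq int) (x : int) :
  wsum w (rcons s x) = wsum w s + (w + (size s)%:Z) * x.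
Proof. by rewrite -cats1 wsum_cat /= addr0. Qed.

Lemma Zp_int_eq0 (m : nat) (c : int) : (1 < m)%N -> (m %| c)%Z ->
  c%:~R = 0 :> 'Z_m.
Proof.
by move=> m_gt1 /dvdzP[l ->]; rewrite rmorphM /= -pmulrn pchar_Zp // mulr0.
Qed.

Lemma val_Zp_int (m : nat) (c : int) : (1 < m)%N ->
  (c%:~R : 'Z_m) = `|(c %% m)%Z|%N :> nat.
Proof.
move=> m_gt1.
have [r rE] : exists r : nat, (c %% m)%Z = r.
  by exists `|(c %% m)%Z|%N; rewrite gez0_abs // modz_ge0 //; lia.
have r_lt : (r < m)%N by rewrite -ltz_nat -rE ltz_pmod //; lia.
rewrite [in LHS](divz_eq c m) rE intrD (@Zp_int_eq0 m (_ * _)) ?dvdz_mull //.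
by rewrite add0r -pmulrn val_Zp_nat // modn_small.
Qed.

Theorem theorem1p5 (m k n : nat) (m_gt0 : (0 < m)%N) (m_even : ~~ odd m)
  (k_ge1 : (1 <= k)%N) (n_odd : odd n) (m_eq : m = (2 ^ k * n)%N)
  (M : m.-tuple 'Z_m)
  (not_same_odd : ~ same_odd_residue (2 ^ k) M)
  (not_exceptional : ~ exceptional_form M) :
  exists s : 'S_m, \sum_(i < m) (i.+1)%:R * tnth M (s i) = 0 :> 'Z_m.
Proof.
have m_gt1 : (1 < m)%N by case: (m) m_gt0 m_even => [|[|]].
have [q mE] : exists q, m = (2 * q)%N by exists m./2; rewrite mul2n even_halfK.
have q_gt0 : (0 < q)%N by lia.
pose toZ (c : int) : 'Z_m := c%:~R.
pose lift (x : 'Z_m) : int := (x : nat)%:Z.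
have liftK : cancel lift toZ by move=> x; rewrite /toZ /lift -pmulrn natr_Zp.
have toZ_eq c d : (m %| c - d)%Z -> toZ c = toZ d.
  by move=> /(Zp_int_eq0 m_gt1); rewrite rmorphB => /subr0_eq.
pose L := map lift M.
have LM : map toZ L = M by rewrite /L -map_comp map_id_in // => x _; apply: liftK.
have L_not_const a : ~~ (2 %| a)%Z ->
    exists2 x, x \in L & ~~ ((2 ^ k)%N %| x - a)%Z.
  move=> a_odd; apply/hasP; apply/negPn/negP => /hasPn L_const.
  apply: not_same_odd; have k_gt0 : (2 ^ k)%N%:Z != 0 by have := expn_gt0 2 k; lia.
  have [r rE] : exists r : nat, (a %% (2 ^ k)%N)%Z = r.
    by exists `|(a %% (2 ^ k)%N)%Z|%N; rewrite gez0_abs // modz_ge0.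
  exists r; split.
    have := divz_eq a (2 ^ k)%N; rewrite rE -(prednK k_ge1) expnS PoszM.
    set l := divz _ _ => aE; set h := (2 ^ _)%N%:Z in aE.
    have {}aE : a = 2 * (l * h) + r%:Z by rewrite {1}aE; ring.
    move: (l * h) aE => l' aE; lia.
  move=> x Mx; have := L_const _ (map_f lift Mx); rewrite negbK -eqz_mod_dvd rE.
  by rewrite /lift modz_nat => /eqP[<-]; rewrite modn_mod.
have LE : size L = (2 * q)%N by rewrite size_map size_tuple.
have qE : (2 * q = 2 ^ k * n)%N by rewrite -mE.
case: (solvable_or_exceptional q_gt0 LE qE n_odd k_ge1 L_not_const); last first.
  case=> a [u [v [r [LP ra a_even uc uv]]]]; case: not_exceptional.
  rewrite -mE in ra uc uv.
  (* Since [m] is even, reduction modulo [m] preserves the parity of [a]. *)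
  exists (toZ a), (toZ (u - a)); split.
  - rewrite /toZ val_Zp_int //.
    have mZ : m%:Z = 2 * q%:Z by rewrite mE PoszM.
    have b_ge0 : 0 <= (a %% m)%Z by rewrite modz_ge0; lia.
    have := divz_eq a m; set l := divz _ _.
    move: (a %% m)%Z b_ge0 => b b_ge0; rewrite mZ mulrCA => aE.
    move: (l * q%:Z) aE => l' aE; lia.
  - rewrite /toZ val_Zp_int // -[m in coprime _ m]/`|m%:Z|%N -coprimezE.
    by rewrite /coprimez gcdz_modl.
  have := perm_map toZ LP; rewrite LM => /perm_trans; apply; rewrite /=.
  have -> : map toZ r = nseq (m - 2) (toZ a).
    have -> : (m - 2)%N = size (map toZ r).
      by have := perm_size LP; rewrite LE size_map /= mE => ->; rewrite subn2.
    apply/all_pred1P/allP => _ /mapP[z rz ->].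
    by apply/eqP/toZ_eq/ra.
  have -> : toZ a + toZ (u - a) = toZ u by rewrite -rmorphD addrC subrK.
  have -> : toZ a - toZ (u - a) = toZ v.
    rewrite -rmorphB; apply: toZ_eq.
    have -> : a - (u - a) - v = - (u + v - 2 * a) by ring.
    by rewrite rpredN.
  by rewrite -[_ :: _]/([:: toZ u; toZ v] ++ _) perm_catC.
case=> t tL; rewrite -mE => mt.
have tE : size t = m by rewrite (perm_size tL) LE.
case: t => [|x t] in tL mt tE; first by rewrite -tE in m_gt0.
(* Moving the term of weight 0 to the end gives it the weight [m], so that the weights become 1,
   ..., m. *)
pose t' := rcons t x.
have t'E : size t' = m by rewrite size_rcons.
have mt' : (m %| wsum 1 t')%Z.
  rewrite wsum_rcons -[size _]/(size (x :: t)).-1 tE.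
  have -> : 1 + m.-1%:Z = m%:Z by lia.
  rewrite rpredD ?dvdz_mulr //.
  by move: mt; rewrite /= mul0r !add0r.
have tM : perm_eq (map toZ t') M.
  by rewrite -LM perm_map // perm_rcons.
have sizeM : size (map toZ t') == m by rewrite size_map t'E.
have /tuple_permP[s sE] : perm_eq (Tuple sizeM) M by [].
exists s; have := Zp_int_eq0 m_gt1 mt'.
rewrite (wsumE _ t'E) rmorph_sum => sum0; apply: etrans sum0.
apply: eq_bigr => i _; rewrite rmorphM /= -intS -pmulrn; congr (_ * _).
have -> : (t'`_i)%:~R = nth 0 (Tuple sizeM) i by rewrite (nth_map 0) // t'E.
by rewrite sE -tnth_nth tnth_mktuple.
Qed.
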